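(* Let $u_1,\dots,u_N\in\mathbb{S}^{n-1}$ be pairwise non-parallel unit vectors such that $\{u_1,\dots,u_N\}$ is not contained in any (great) subsphere of $\mathbb{S}^{n-1}$, i.e. they span $\mathbb{R}^n$. Let $P$ be any origin-symmetric polytope in $\mathbb{R}^n$ with $\mathrm{supp}\,S_P=\{\pm u_1,\dots,\pm u_N\}$ and $V_n(P)=n$, and suppose $P=P_1\oplus\cdots\oplus P_l$, where $\dim P_i>0$ and $P_i$ is directly indecomposable for $i=1,\dots,l$. Then $$\dim P_{M(u_1,\dots,u_N)}=N-l.$$
   Context: $V_n$ is $n$-dimensional volume; $S_P$ is the surface area measure of $P$, so $\mathrm{supp}\,S_P$ is the set of unit outer normals of the facets of $P$. For a convex body $K$, one writes $K=K_1\oplus\cdots\oplus K_l$ if $K=K_1+\cdots+K_l$ (Minkowski sum) with compact convex sets $K_i$ lying in linear subspaces $\xi_i$ such that the ambient space is the direct sum $\xi_1\oplus\cdots\oplus\xi_l$. $K$ is directly indecomposable if $K=L\oplus M$ is only possible with $\dim L=0$ or $\dim M=0$ (for $P_i$ this is understood in the linear span of $P_i$). $M(u_1,\dots,u_N)$ is the linear matroid on $E=\{1,\dots,N\}$ whose independent sets are the sets $I\subseteq E$ for which $u_i$, $i\in I$, are linearly independent (and $\emptyset$); its bases are the sets $B\subseteq E$ for which $\{u_i:i\in B\}$ is a basis of $\mathbb{R}^n$. The associated matroid polytope is $$P_{M(u_1,\dots,u_N)}=\mathrm{conv}\Big\{\sum_{i\in B}e_i: B\text{ a basis of }M(u_1,\dots,u_N)\Big\}\subseteq\mathbb{R}^N,$$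 where $e_1,\dots,e_N$ is the standard basis of $\mathbb{R}^N$; $\dim$ of a polytope is the dimension of its affine hull. *)

(* Defs.v *)
From HB Require Import structures.
From mathcomp Require Import all_boot all_order all_algebra.
From mathcomp Require Import all_classical all_reals all_analysis.
Set Implicit Arguments.
Unset Strict Implicit.
Unset Printing Implicit Defensive.
Import Order.TTheory GRing.Theory Num.Theory.
Import numFieldNormedType.Exports.
Local Open Scope classical_set_scope.
Local Open Scope ring_scope.

Section AffineGeometry.
Context {R : realType} {V : vectType R}.
Implicit Types (A : set V).

Definition conv_hull A : set V :=
  smallest (@convex_set R (convex_lmodType V)) A.

Definition affine_set A : Prop :=
  forall (x y : V) (t : R), A x -> A y -> A (t *: x + (1 - t) *: y).

Definition aff_hull A : set V := smallest affine_set A.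

(* For nonempty A the affine hull is a coset x + W of a unique subspace W,
   which [xget] picks out; the empty set gets the junk value 0. *)
Definition affdim A : nat :=
  \dim (xget 0%VS [set W : {vspace V} |
    exists x : V, aff_hull A = [set x + w | w in [set` W]]]).

(* The least subspace containing A (it always exists, V being
   finite-dimensional, so the default of [xget] is never used). *)
Definition lin_span A : {vspace V} :=
  xget fullv [set W : {vspace V} | A `<=` [set` W] /\
    forall W' : {vspace V}, A `<=` [set` W'] -> (W <= W')%VS].

Definition polytope A : Prop :=
  exists S : set V, [/\ finite_set S, S !=set0 & A = conv_hull S].

Definition origin_symmetric A : Prop := A = [set - x | x in A].

Definition minkowski_sum (l : nat) (K : 'I_l -> set V) : set V :=
  [set x | exists2 y : 'I_l -> V, (forall i, K i (y i)) & x = \sum_i y i].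

End AffineGeometry.

Section Euclidean.
Context {R : realType}.

(* The library norm on 'rV[R]_n is the sup norm, so the Euclidean structure is
   given by [dot]; the two norms define the same topology. *)
Definition dot (n : nat) (x y : 'rV[R]_n) : R := \sum_i x 0 i * y 0 i.

Definition usphere (n : nat) : set 'rV[R]_n := [set x | dot x x = 1].

(* n-dimensional Lebesgue measure as the iterated product of the
   one-dimensional one: vol_(n+1) is the product of lebesgue_measure and vol_n,
   integrated over the sections as in [product_measure1]. *)
Fixpoint vol (n : nat) : set 'rV[R]_n -> \bar R :=
  match n with
  | 0%N => fun A => (\1_A 0)%:E
  | m.+1 => fun A =>
      (\int[lebesgue_measure]_t
         vol [set y : 'rV[R]_m | A (row_mx (t%:M : 'rV[R]_1) y)])%E
  end.

Definition face (n : nat) (P : set 'rV[R]_n) (u : 'rV[R]_n) : set 'rV[R]_n :=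
  [set x | P x /\ forall y, P y -> dot y u <= dot x u].

(* (n-1)-dimensional volume of a set F lying in a hyperplane orthogonal to the
   unit vector u: the volume of the right prism of height 1 over F. *)
Definition hyperplane_vol (n : nat) (u : 'rV[R]_n) (F : set 'rV[R]_n) : \bar R :=
  vol [set z | exists x t, [/\ F x, 0 <= t <= 1 & z = x + t *: u]].

(* Surface area measure of a polytope: the sum of V_(n-1)(F) over the facets F
   whose unit outer normal lies in w.  Unit vectors u that are not facet normals
   contribute 0, since then face P u has dimension < n - 1. *)
Definition surface_area (n : nat) (P : set 'rV[R]_n) (w : set 'rV[R]_n) : \bar R :=
  (\esum_(u in w `&` @usphere n) hyperplane_vol u (face P u))%E.

Definition sphere_support (n : nat) (mu : set 'rV[R]_n -> \bar R) : set 'rV[R]_n :=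
  [set u | usphere u /\ forall U, nbhs u U -> (0 < mu (U `&` @usphere n))%E].

(* K = K_1 (+) ... (+) K_l inside the ambient space W. *)
Definition direct_sum (n : nat) (W : {vspace 'rV[R]_n}) (l : nat)
    (K : set 'rV[R]_n) (Ks : 'I_l -> set 'rV[R]_n) : Prop :=
  K = minkowski_sum Ks /\
  exists xi : 'I_l -> {vspace 'rV[R]_n},
    [/\ directv (\sum_i xi i)%VS,
        (\sum_i xi i)%VS = W
      & forall i, [/\ compact (Ks i),
                      convex_set (Ks i : set (convex_lmodType 'rV[R]_n))
                    & Ks i `<=` [set` xi i]]].

Definition directly_indecomposable (n : nat) (W : {vspace 'rV[R]_n})
    (K : set 'rV[R]_n) : Prop :=
  forall L : 'I_2 -> set 'rV[R]_n, direct_sum W K L ->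
    affdim (L ord0) = 0%N \/ affdim (L ord_max) = 0%N.

Definition matroid_basis (n N : nat) (u : 'I_N -> 'rV[R]_n) (B : {set 'I_N}) : bool :=
  basis_of fullv [seq u i | i in B].

Definition matroid_polytope (n N : nat) (u : 'I_N -> 'rV[R]_n) : set 'rV[R]_N :=
  conv_hull [set \sum_(i in B) delta_mx 0 i | B in [set B | matroid_basis u B]].

End Euclidean.

(* Main.v *)
(* Write P = P_1 (+) ... (+) P_l with P_i in xi_i.  A vector w that is orthogonal
   to neither xi_i nor xi_j, i <> j, is not a facet normal: on the face of P in
   direction w two independent functionals are constant.  Hence each u_k is
   orthogonal to all xi_i but one, xi_(sg k), which splits the vectors u_k into l
   nonempty blocks.  By a trace computation all bases have the same number of
   elements in each block, so the matroid polytope satisfies l independent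
   affine equations.

   Conversely, let c be a weight that all bases share.  By basis exchange, the
   coordinate of u_k along u_b in a basis can be nonzero only if c_b = c_k, so
   R^n is the direct sum of the spans of the level sets of c.  A polytope with
   nonempty interior is the intersection of its facet half-spaces (Fourier-Motzkin
   elimination, then removal of redundant constraints), so if c took two values on
   one block, the dual splitting would decompose the corresponding P_i.  Hence c is
   constant on blocks and there are no further affine equations. *)
Require Import Defs.
From HB Require Import structures.
From mathcomp Require Import all_boot all_order all_algebra.
From mathcomp Require Import all_classical all_reals all_analysis.
From mathcomp Require Import ring lra.
Set Implicit Arguments.
Unset Strict Implicit.
Unset Printing Implicit Defensive.
Import Order.TTheory GRing.Theory Num.Theory.
Import numFieldNormedType.Exports.
Local Open Scope classical_set_scope.
Local Open Scope ring_scope.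

(** * Bilinearity, definiteness and continuity of the Euclidean product *)

Section Dot.
Context {R : realType}.

Lemma dotC n (x y : 'rV[R]_n) : dot x y = dot y x.
Proof. by apply: eq_bigr => i _; rewrite mulrC. Qed.

Lemma dotDl n (x y z : 'rV[R]_n) : dot (x + y) z = dot x z + dot y z.
Proof. by rewrite -big_split; apply: eq_bigr => i _; rewrite mxE mulrDl. Qed.

Lemma dotZl n a (x y : 'rV[R]_n) : dot (a *: x) y = a * dot x y.
Proof. by rewrite mulr_sumr; apply: eq_bigr => i _; rewrite mxE mulrA. Qed.

Lemma dotDr n (x y z : 'rV[R]_n) : dot x (y + z) = dot x y + dot x z.
Proof. by rewrite dotC dotDl !(dotC x). Qed.

Lemma dotZr n a (x y : 'rV[R]_n) : dot x (a *: y) = a * dot x y.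
Proof. by rewrite dotC dotZl dotC. Qed.

Lemma dotNl n (x y : 'rV[R]_n) : dot (- x) y = - dot x y.
Proof. by rewrite -scaleN1r dotZl mulN1r. Qed.

Lemma dotNr n (x y : 'rV[R]_n) : dot x (- y) = - dot x y.
Proof. by rewrite dotC dotNl dotC. Qed.

Lemma dotBl n (x y z : 'rV[R]_n) : dot (x - y) z = dot x z - dot y z.
Proof. by rewrite dotDl dotNl. Qed.

Lemma dotBr n (x y z : 'rV[R]_n) : dot x (y - z) = dot x y - dot x z.
Proof. by rewrite dotDr dotNr. Qed.

Lemma dot0l n (y : 'rV[R]_n) : dot 0 y = 0.
Proof. by rewrite -(scale0r 0) dotZl mul0r. Qed.

Lemma dot0r n (y : 'rV[R]_n) : dot y 0 = 0.
Proof. by rewrite dotC dot0l. Qed.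

Lemma dot_suml n (I : Type) (r : seq I) (Q : pred I) (F : I -> 'rV[R]_n) y :
  dot (\sum_(i <- r | Q i) F i) y = \sum_(i <- r | Q i) dot (F i) y.
Proof.
by elim/big_rec2: _ => [|i a b _ <-]; rewrite ?dot0l ?dotDl.
Qed.

Lemma dot_deltar n (x : 'rV[R]_n) i : dot x (delta_mx 0 i) = x 0 i.
Proof.
rewrite /dot (bigD1 i) //= mxE !eqxx mulr1 big1 ?addr0 // => j /negPf ji.
by rewrite mxE ji andbF mulr0.
Qed.

Lemma dot_eq0 n (x : 'rV[R]_n) : (dot x x == 0) = (x == 0).
Proof.
apply/idP/eqP => [|->]; last by rewrite dot0l.
rewrite psumr_eq0 => [/allP x0|i _]; last by rewrite -expr2 sqr_ge0.
apply/rowP => i; have := x0 i; rewrite mem_index_enum mxE => /(_ isT) /=.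
by rewrite mulf_eq0 orbb => /eqP.
Qed.

Lemma dot_ge0 n (x : 'rV[R]_n) : 0 <= dot x x.
Proof. by apply: sumr_ge0 => i _; rewrite -expr2 sqr_ge0. Qed.

Lemma dot_gt0 n (x : 'rV[R]_n) : x != 0 -> 0 < dot x x.
Proof. by move=> x0; rewrite lt_neqAle eq_sym dot_eq0 x0 dot_ge0. Qed.

Lemma dot_row_mx m n (a b : 'rV[R]_m) (x y : 'rV[R]_n) :
  dot (row_mx a x) (row_mx b y) = dot a b + dot x y.
Proof.
by rewrite /dot big_split_ord /=; congr (_ + _); apply: eq_bigr => i _;
  rewrite ?row_mxEl ?row_mxEr.
Qed.

Lemma dot_mulmx n (x y : 'rV[R]_n) (Q : 'M[R]_n) :
  dot x (y *m Q) = dot (x *m Q^T) y.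
Proof.
have dotE (a b : 'rV[R]_n) : dot a b = (a *m b^T) 0 0.
  by rewrite mxE; apply: eq_bigr => i _; rewrite mxE.
by rewrite !dotE trmx_mul mulmxA.
Qed.

Lemma linear_dot n (f : 'rV[R]_n -> R) :
  (forall a x y, f (a *: x + y) = a * f x + f y) ->
  exists w, forall x, f x = dot x w.
Proof.
move=> lf; exists (\row_i f (delta_mx 0 i)) => x.
have f0 : f 0 = 0 by have := lf (-1) 0 0; rewrite scaler0 addr0; lra.
rewrite {1}(row_sum_delta x) /dot.
under [RHS]eq_bigr do rewrite mxE.
by elim/big_rec2: _ => [//|i a b _ <-]; rewrite lf.
Qed.

Lemma dot_continuous n (y : 'rV[R]_n) : continuous (fun x : 'rV[R]_n => dot x y).
Proof.
have coordZ i : continuous (fun x : 'rV[R]_n => x 0 i * y 0 i).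
  by move=> x; exact: (cvgM (@coord_continuous R 1 n 0 i x) (cvg_cst (y 0 i))).
by apply: (@continuous_big R) => [|i _]; [exact: add_continuous|exact: coordZ].
Qed.

End Dot.

(** * Volume: null sets in hyperplanes, positivity on neighborhoods *)

Section Volume.
Context {R : realType}.

Lemma vol_ge0 n (A : set 'rV[R]_n) : (0 <= vol A)%E.
Proof.
elim: n A => [|n IH] A /=; first by rewrite lee_fin.
by apply: integral_ge0 => t _; exact: IH.
Qed.

(* No measurability is required, the integral of a nonnegative function being the
   supremum of the integrals of the simple functions below it. *)
Lemma ge0_le_integral_nonmeasurable (f g : R -> \bar R) :
  (forall x, 0 <= f x)%E -> (forall x, f x <= g x)%E ->
  (\int[lebesgue_measure]_x f x <= \int[lebesgue_measure]_x g x)%E.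
Proof.
move=> f0 fg; have g0 x : (0 <= g x)%E by exact: le_trans (f0 x) (fg x).
rewrite !ge0_integralTE //; apply: ereal_sup_le => _ [h hf <-].
by exists h => // x; exact: le_trans (hf x) (fg x).
Qed.

Lemma vol_set0 n : vol (set0 : set 'rV[R]_n) = 0%E.
Proof.
elim: n => [|n IH] /=; first by rewrite indicE in_set0.
by apply: integral0_eq => t _; exact: IH.
Qed.

(** Induction on the dimension. If the tail [w2] of [w] is nonzero, every section lies in a
    hyperplane again; otherwise only the section at [c / w1 0 0] can be nonempty, so the integrand
    lives on one point. *)
Lemma vol_hyperplane n (A : set 'rV[R]_n) (w : 'rV[R]_n) (c : R) :
  w != 0 -> (forall x, A x -> dot x w = c) -> vol A = 0%E.
Proof.
elim: n A w c => [|n IH] A w c.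
  by rewrite thinmx0 eqxx.
move=> w0 Aw /=.
pose w1 : 'rV[R]_1 := lsubmx (w : 'rV_(1 + n)).
pose w2 : 'rV[R]_n := rsubmx (w : 'rV_(1 + n)).
have wE : w = row_mx w1 w2 by rewrite hsubmxK.
have sec t y : A (row_mx (t%:M : 'rV_1) y) -> t * w1 0 0 + dot y w2 = c.
  move=> /Aw <-; rewrite wE; apply: etrans (esym (dot_row_mx (t%:M) w1 y w2)).
  by rewrite /dot big_ord1 !mxE eqxx mulr1n.
have [w20|w20] := eqVneq w2 0; last first.
  apply: integral0_eq => t _; apply: (IH _ w2 (c - t * w1 0 0)) => // y /sec.
  by move=> <-; rewrite addrC addKr.
have w10 : w1 0 0 != 0.
  apply: contra_neq w0 => w10; rewrite wE w20.
  have -> : w1 = 0 by apply/rowP => i; rewrite ord1 w10 mxE.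
  by rewrite row_mx0.
pose f t := vol [set y : 'rV[R]_n | A (row_mx (t%:M : 'rV_1) y)].
rewrite (_ : (fun _ => _) = f) //.
rewrite (_ : f = f \_ [set c / w1 0 0]); last first.
  apply/funext => t; rewrite /patch; case: ifPn => // /negP tc.
  rewrite /f (_ : [set _ | _] = set0); first last.
    apply/seteqP; split=> // y /= /sec; rewrite w20 dot0r addr0 => tw.
    by apply: tc; rewrite inE /= -tw mulfK.
  exact: vol_set0.
by rewrite -integral_mkcond integral_set1.
Qed.

Lemma row_mx_box m n (a b : 'rV[R]_m) (x y : 'rV[R]_n) (r : R) :
  (forall i, `|a 0 i - b 0 i| < r) -> (forall i, `|x 0 i - y 0 i| < r) ->
  forall i, `|row_mx a x 0 i - row_mx b y 0 i| < r.
Proof. by move=> ab xy i; case: (split_ordP i) => j ->; rewrite ?row_mxEl ?row_mxEr. Qed.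

(** Each integration runs over an interval of length [2 r]; the cruder factor [r] suffices for
    positivity. *)
Lemma vol_box n (A : set 'rV[R]_n) (z : 'rV[R]_n) (r : R) :
  0 < r -> (forall y : 'rV[R]_n, (forall i, `|y 0 i - z 0 i| < r) -> A y) ->
  ((r ^+ n)%:E <= vol A)%E.
Proof.
move=> r0; elim: n A z => [|n IH] A z Az /=.
  by rewrite expr0 lee_fin indicE mem_set //; apply: Az => -[].
pose z1 : 'rV[R]_1 := lsubmx (z : 'rV_(1 + n)).
pose z2 : 'rV[R]_n := rsubmx (z : 'rV_(1 + n)).
have zE : z = row_mx z1 z2 by rewrite hsubmxK.
pose B : set R := ball (z1 0 0) r.
pose g := cst (r ^+ n)%:E \_ B.
apply: (@le_trans _ _ (\int[lebesgue_measure]_t g t)%E); last first.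
  apply: ge0_le_integral_nonmeasurable => t; rewrite /g /patch /=.
    by case: ifP => // _; rewrite lee_fin exprn_ge0 // ltW.
  case: ifPn => tB; last exact: vol_ge0.
  apply: (IH _ z2) => y yz /=; apply: Az.
  rewrite zE; apply: (@row_mx_box 1 n) => // i.
  rewrite ord1 mxE eqxx mulr1n distrC.
  by move: tB; rewrite inE.
have muB : lebesgue_measure B = (r *+ 2)%:E by apply: lebesgue_measure_ball; exact: ltW.
rewrite /g -integral_mkcond integral_cst; last exact: measurable_realfun.measurable_ball.
rewrite [X in (_ * X)%E]muB -EFinM lee_fin exprSr ler_wpM2l ?exprn_ge0 ?(ltW r0) //.
by rewrite mulr2n lerDl ltW.
Qed.

Lemma vol_nbhs n (A : set 'rV[R]_n) (z : 'rV[R]_n) : nbhs z A -> (0 < vol A)%E.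
Proof.
move=> /nbhs_ballP[r /= r0 rA].
apply: (@lt_le_trans _ _ (r ^+ n)%:E); first by rewrite lte_fin exprn_gt0.
apply: (@vol_box _ _ z) => // y yz; apply: rA; split=> // i j.
by rewrite ord1 /ball /= distrC.
Qed.

End Volume.

(** * Polytopes as finite intersections of half-spaces *)

Section Polyhedron.
Context {R : realType}.

(** The recursion splits off one generator at a time, which is the form that Fourier-Motzkin
    elimination treats. *)
Fixpoint in_cone m (s : seq 'rV[R]_m) (x : 'rV[R]_m) : Prop :=
  if s is v :: s' then exists2 t, 0 <= t & in_cone s' (x - t *: v) else x = 0.

Lemma ge0_upper_bound (s : seq R) :
  exists t, [/\ 0 <= t, t \in 0 :: s & forall x, x \in s -> x <= t].
Proof.
elim: s => [|y s [t [t0 ts st]]]; first by exists 0; rewrite mem_head.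
have [yt|ty] := leP y t.
  exists t; split=> // [|x].
    by move: ts; rewrite !inE => /orP[->//|->]; rewrite !orbT.
  by rewrite inE => /predU1P[->//|/st].
exists y; split=> [||x]; first by rewrite (le_trans t0) // ltW.
  by rewrite !inE eqxx orbT.
by rewrite inE => /predU1P[->//|/st/le_trans->//]; rewrite ltW.
Qed.

(** The constraint [a] bounds [t] from above if [dot v a > 0], from below if [dot v a < 0], and does
    not involve [t] if [dot v a = 0]. So [t >= 0] exists iff the upper bounds are nonnegative and no
    lower bound exceeds an upper one. *)
Lemma fourier_motzkin m (L : seq 'rV[R]_m) (v : 'rV[R]_m) :
  exists L' : seq 'rV[R]_m, forall x,
    (exists2 t, 0 <= t & forall a, a \in L -> 0 <= dot (x - t *: v) a) <->
    (forall a, a \in L' -> 0 <= dot x a).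
Proof.
exists ([seq a <- L | 0 <= dot v a] ++
  [seq dot v a *: b - dot v b *: a | a <- [seq a <- L | 0 < dot v a],
                                     b <- [seq b <- L | dot v b < 0]]) => x.
split=> [[t t0 xt] a|xL].
  rewrite mem_cat mem_filter => /orP[/andP[va aL]|].
    have := xt a aL; rewrite dotBl dotZl subr_ge0; apply: le_trans.
    exact: mulr_ge0.
  case/allpairsP=> -[p q] /= []; rewrite !mem_filter => /andP[vp pL] /andP[vq qL] ->.
  have := xt p pL; have := xt q qL; rewrite !dotBl !dotZl dotBr !dotZr.
  move=> /(ler_wpM2l (ltW vp)); rewrite mulr0 => xq.
  rewrite -oppr_gt0 in vq.
  move=> /(ler_wpM2l (ltW vq)); rewrite mulr0 => xp.
  by have := addr_ge0 xp xq; congr (_ <= _); ring.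
(* The largest lower bound is taken for [t]; being attained, it can be compared with each upper
   bound through [L']. *)
have [t [t0 tin tub]] := ge0_upper_bound [seq dot x b / dot v b | b <- L & dot v b < 0].
exists t => // a aL; rewrite dotBl dotZl subr_ge0.
have xa : 0 <= dot v a -> 0 <= dot x a.
  by move=> va; apply: xL; rewrite mem_cat mem_filter va aL.
case: (ltgtP 0 (dot v a)) => va; last by rewrite -va mulr0 xa // -va.
- move: tin; rewrite inE => /predU1P[->|]; first by rewrite mul0r xa // ltW.
  case/mapP=> b; rewrite mem_filter => /andP[vb bL] ->.
  have : 0 <= dot x (dot v a *: b - dot v b *: a).
    apply: xL; rewrite mem_cat; apply/orP; right; apply/allpairsP.
    by exists (a, b); rewrite /= !mem_filter va vb aL bL.
  rewrite dotBr !dotZr subr_ge0 => xab.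
  by rewrite mulrAC ler_ndivrMr // mulrC (mulrC (dot x b)).
- rewrite -ler_ndivrMr //; apply: tub; apply/mapP; exists a => //.
  by rewrite mem_filter va.
Qed.

(** The zero cone is cut out by both signs of every coordinate; each further generator is handled by
    one elimination. *)
Lemma cone_polyhedral m (s : seq 'rV[R]_m) :
  exists L : seq 'rV[R]_m, forall x,
    in_cone s x <-> forall a, a \in L -> 0 <= dot x a.
Proof.
elim: s => [|v s [L sL]].
  exists ([seq delta_mx 0 i | i : 'I_m] ++ [seq - delta_mx 0 i | i : 'I_m]) => x.
  split=> [-> a _|xL]; first by rewrite dot0l.
  apply/rowP => i; rewrite mxE; apply/eqP; rewrite eq_le; apply/andP; split.
    rewrite -oppr_ge0 -dot_deltar -dotNr; apply: xL; rewrite mem_cat; apply/orP.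
    by right; apply/mapP; exists i; rewrite // mem_enum.
  rewrite -dot_deltar; apply: xL; rewrite mem_cat; apply/orP.
  by left; apply/mapP; exists i; rewrite // mem_enum.
have [L' LL'] := fourier_motzkin L v.
exists L' => x; rewrite -LL'; split=> -[t t0 h]; exists t => //; exact/sL.
Qed.

Lemma convex_setP (V : lmodType R) (C : set V) :
  convex_set (C : set (convex_lmodType V)) <->
  (forall x y t, 0 <= t <= 1 -> C x -> C y -> C (t *: x + (1 - t) *: y)).
Proof.
split=> [cC x y t t01 Cx Cy|cC x y t /set_mem Cx /set_mem Cy].
  have := cC x y (Itv01 (proj1 (andP t01)) (proj2 (andP t01))).
  by move=> /(_ (mem_set Cx) (mem_set Cy)) /set_mem.
by apply/mem_set; apply: cC => //; rewrite ge0 le1.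
Qed.

(** Splitting off [r] times the generator [v], the point [t^-1 *: x] is a convex combination of [v],
    with weight [r / t], and of the rest rescaled by [(t - r)^-1]. The clause for [t = 0] covers a
    rest of height zero. *)
Lemma cone_convex n (s : seq 'rV[R]_n) (C : set 'rV[R]_n) (x : 'rV[R]_n) (t : R) :
  convex_set (C : set (convex_lmodType 'rV[R]_n)) ->
  (forall v, v \in s -> C v) ->
  in_cone [seq row_mx v (1 : 'rV[R]_1) | v <- s] (row_mx x (t%:M : 'rV[R]_1)) ->
  [/\ 0 <= t, t = 0 -> x = 0 & 0 < t -> C (t^-1 *: x)].
Proof.
move=> /convex_setP cC; elim: s x t => [|v s IH] x t sC /=.
  rewrite -[RHS]row_mx0 => /eq_row_mx[-> /rowP/(_ 0)].
  by rewrite !mxE eqxx mulr1n => ->; rewrite ltxx.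
case=> r r0; rewrite scale_row_mx opp_row_mx add_row_mx.
have -> : (t%:M - r *: 1 : 'rV[R]_1) = (t - r)%:M.
  by apply/rowP => i; rewrite ord1 !mxE eqxx !mulr1n mulr1.
case/IH => [w ws|]; first by apply: sC; rewrite inE ws orbT.
rewrite subr_ge0 => rt tr0 trC.
split; first exact: le_trans rt.
  move=> t0; have r00 : r = 0 by lra.
  by have := tr0; rewrite t0 r00 scale0r !subr0; apply.
move=> t0; have Cv : C v by apply: sC; rewrite mem_head.
have [tr|tr] := eqVneq t r.
  have -> : x = r *: v by apply/eqP; rewrite -subr_eq0 tr0 // tr subrr.
  by rewrite tr scalerA mulVf ?scale1r // -tr gt_eqF.
have {}tr : 0 < t - r by rewrite subr_gt0 lt_neqAle eq_sym tr rt.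
have := cC _ _ (r / t) _ Cv (trC tr).
rewrite divr_ge0 ?(ltW t0) //= ler_pdivrMr // mul1r => /(_ rt).
congr C; rewrite !scalerA.
have -> : (1 - r / t) / (t - r) = t^-1 by field; rewrite !gt_eqF.
by rewrite scalerBr scalerA addrC [r / t]mulrC subrK.
Qed.

Lemma in_cone_mem m (s : seq 'rV[R]_m) v : v \in s -> in_cone s v.
Proof.
have cone0 (s' : seq 'rV[R]_m) : in_cone s' 0.
  by elim: s' => //= w s' IH; exists 0; rewrite // scale0r subr0.
elim: s v => //= w s IH v; rewrite inE => /predU1P[->|/IH vs].
  by exists 1; rewrite // scale1r subrr.
by exists 0; rewrite // scale0r subr0.
Qed.

Lemma half_space_convex n (a : 'rV[R]_n) c :
  convex_set ([set x | dot x a <= c] : set (convex_lmodType 'rV[R]_n)).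
Proof.
apply/convex_setP => x y t /andP[t0 t1] /= xa ya.
rewrite dotDl !dotZl.
have : t * dot x a <= t * c by rewrite ler_wpM2l.
have : (1 - t) * dot y a <= (1 - t) * c by rewrite ler_wpM2l // subr_ge0.
lra.
Qed.

(* Homogenization: the hull of the points [v] is the section at height 1 of the
   cone over the points [(v, 1)]. *)
Lemma polytope_polyhedral n (P : set 'rV[R]_n) : polytope P ->
  exists L : seq ('rV[R]_n * R),
    P = [set x | forall a, a \in L -> dot x a.1 <= a.2].
Proof.
case=> S [/finite_seqP[s ->] _ ->].
have [L sL] := cone_polyhedral [seq row_mx v (1 : 'rV[R]_1) | v <- s].
(* At height 1 the constraint [a] reads [0 <= dot x (lsubmx a) + rsubmx a 0 0]. *)
exists [seq (- lsubmx a, rsubmx a 0 0) | a <- L].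
have LE x : (forall a, a \in [seq (- lsubmx a, rsubmx a 0 0) | a <- L] ->
      dot x a.1 <= a.2) <-> in_cone [seq row_mx v (1 : 'rV[R]_1) | v <- s]
      (row_mx x (1 : 'rV[R]_1)).
  rewrite sL.
  have E a : (dot x (- lsubmx a) <= rsubmx a 0 0) = (0 <= dot (row_mx x (1 : 'rV[R]_1)) a).
    rewrite -{3}(hsubmxK a) dot_row_mx dotNr lerNl -subr_ge0 opprK.
    by congr (0 <= _ + _); rewrite /dot big_ord1 [_ 1 0 0]mxE eqxx mul1r.
  split=> h a; first by move=> aL; rewrite -E; apply: h (map_f _ aL).
  by case/mapP=> b /h bL ->; rewrite E.
apply/seteqP; split=> x.
  move=> hx a aL; apply: (hx [set y | dot y a.1 <= a.2]); split.
    exact: half_space_convex.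
  move=> y /= ys; apply: (proj2 (LE y)) aL.
  by apply: in_cone_mem; exact: map_f.
move=> /= /LE xs C [cC sC].
have [||_ _ /(_ ltr01)] := @cone_convex n s C x 1 cC.
- by move=> v vs; apply: sC.
- by [].
- by rewrite invr1 scale1r.
Qed.

End Polyhedron.

(** * Irredundant half-spaces and facet normals *)

Section Facets.
Context {R : realType}.

Definition half_spaces n (L : seq ('rV[R]_n * R)) : set 'rV[R]_n :=
  [set x | forall a, a \in L -> dot x a.1 <= a.2].

Lemma near_dot_lt n (L : seq ('rV[R]_n * R)) (z : 'rV[R]_n) :
  (forall a, a \in L -> dot z a.1 < a.2) ->
  nbhs z [set y | forall a, a \in L -> dot y a.1 < a.2].
Proof.
elim: L => [|b L IH] zL; first by apply: filterS (@filterT _ (nbhs z) _).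
have zb : dot z b.1 < b.2 by apply: zL; rewrite mem_head.
have zL' a : a \in L -> dot z a.1 < a.2 by move=> aL; apply: zL; rewrite inE aL orbT.
apply: filterS2 (cvgr_lt _ (@dot_continuous _ _ b.1 z) _ zb) (IH zL').
by move=> y yb yL a; rewrite inE => /predU1P[->//|/yL].
Qed.

Lemma facet_support n (P : set 'rV[R]_n) (w : 'rV[R]_n) :
  usphere w -> (0 < hyperplane_vol w (face P w))%E ->
  sphere_support (surface_area P) w.
Proof.
move=> w1 Pw; split=> // U /nbhs_singleton Uw.
apply: lt_le_trans Pw _; apply: esum_ge.
exists [set w]; last by rewrite fsbig_set1.
by split; [exact: finite_set1|move=> _ ->].
Qed.

(** The definition of the support yields normals near [w], not [w] itself; this is enough for
    testing open conditions. *)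
Lemma support_facet n (P : set 'rV[R]_n) (w : 'rV[R]_n) U :
  sphere_support (surface_area P) w -> nbhs w U ->
  exists2 v, U v & usphere v /\ hyperplane_vol v (face P v) <> 0%E.
Proof.
move=> [_ Pw] /Pw; rewrite /surface_area => PU; apply/not_exists2P => nU.
move: PU; rewrite esum1 ?ltxx // => v [[Uv v1] _].
by have [//|vv] := nU v; apply/eqP/negPn/negP => /eqP ?; apply: vv.
Qed.

(** A constraint that no point violates alone follows from the others and is dropped; the length
    decreases. *)
Lemma half_spaces_irredundant n (L : seq ('rV[R]_n * R)) :
  exists2 L', half_spaces L' = half_spaces L &
    forall a, a \in L' -> exists2 x, a.2 < dot x a.1 &
      forall b, b \in L' -> b != a -> dot x b.1 <= b.2.
Proof.
have [k] := ubnP (size L); elim: k L => // k IH L Lk.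
have [irr|] := pselect (forall a, a \in L -> exists2 x, a.2 < dot x a.1 &
      forall b, b \in L -> b != a -> dot x b.1 <= b.2); first by exists L.
move=> /existsNP[a /not_implyP[aL na]].
have [|L' L'E irr] := IH (rem a L).
  rewrite size_rem //; apply: (@leq_trans (size L)); last by [].
  by rewrite prednK //; case: (L) aL.
exists L' => //; rewrite L'E; apply/seteqP; split=> x xL b bL; last first.
  by apply: xL; exact: mem_rem bL.
have [->|ba] := eqVneq b a; last first.
  apply: xL; move: bL; rewrite (perm_mem (perm_to_rem aL)) inE (negPf ba).
  by [].
rewrite leNgt; apply/negP => xa; apply: na; exists x => // d dL da.
apply: xL; move: dL; rewrite (perm_mem (perm_to_rem aL)) inE (negPf da).
by [].
Qed.

(* The segment from 0 to [x] leaves the polyhedron at a point [y] that satisfies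
   every other constraint strictly, so the facet contains a neighborhood of [y]
   in its hyperplane. *)
Lemma irredundant_facet n (L : seq ('rV[R]_n * R)) (a : 'rV[R]_n * R) (x w : 'rV[R]_n)
    (r : R) :
  (forall b, b \in L -> 0 < b.2) -> a \in L -> a.2 < dot x a.1 ->
  (forall b, b \in L -> b != a -> dot x b.1 <= b.2) ->
  usphere w -> 0 < r -> a.1 = r *: w ->
  (0 < hyperplane_vol w (face (half_spaces L) w))%E.
Proof.
move=> L0 aL xa xL w1 r0 aw.
have a0 := L0 _ aL; have xa0 := lt_trans a0 xa.
pose s := a.2 / dot x a.1; pose d := a.2 / r; pose y := s *: x.
have s0 : 0 < s by rewrite divr_gt0.
have s1 : s < 1 by rewrite ltr_pdivrMr // mul1r.
have yw : dot y w = d.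
  have : dot y a.1 = a.2 by rewrite dotZl /s divfK // gt_eqF.
  by rewrite /d aw dotZr => <-; rewrite [r * _]mulrC mulfK // gt_eqF.
have yL b : b \in L -> b != a -> dot y b.1 < b.2.
  move=> bL ba; rewrite dotZl; have b0 := L0 _ bL.
  have [xb|xb] := leP (dot x b.1) 0.
    by apply: le_lt_trans b0; rewrite pmulr_rle0.
  by apply: lt_le_trans (xL _ bL ba); rewrite gtr_pMl.
(* The first two entries confine the height [dot z w] to the interval from [d] to [1 + d]; the
   others say that the projection of [z] to the hyperplane at height [d] satisfies the remaining
   constraints strictly. The point [y + w / 2] meets all of them. *)
clearbody y; pose M := [:: (w, 1 + d), (- w, - d) &
  [seq (b.1 - dot w b.1 *: w, b.2 - d * dot w b.1) | b <- L & b != a]].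
have w11 : dot w w = 1 by [].
apply: (@vol_nbhs _ _ _ (y + 2^-1 *: w)); apply: filterS (@near_dot_lt _ M _ _).
  move=> z zM; exists (z - (dot z w - d) *: w), (dot z w - d); split; last 1 first.
  - by rewrite subrK.
  - have zw : dot (z - (dot z w - d) *: w) w = d.
      by rewrite dotBl dotZl w11 mulr1 subKr.
    split=> [b bL|v vL]; last first.
      rewrite zw ler_pdivlMr // mulrC -dotZr -aw; exact: vL.
    have [->|ba] := eqVneq b a.
      by rewrite aw dotZr zw /d mulrC divfK // gt_eqF.
    have : (b.1 - dot w b.1 *: w, b.2 - d * dot w b.1) \in M.
      rewrite !inE; apply/orP; right; apply/orP; right; apply/mapP; exists b => //.
      by rewrite mem_filter ba.
    move/zM => /= {}zb; rewrite ltW // dotBl dotZl.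
    by move: zb; rewrite dotBr dotZr; lra.
  have zM1 := zM _ (mem_head _ _); have zM2 : dot z (- w) < - d.
    by apply: (zM (- w, - d)); rewrite !inE eqxx orbT.
  by move: zM1 zM2; rewrite /= dotNr => zM1 zM2; apply/andP; split; lra.
move=> b; rewrite !inE => /orP[/eqP->|/orP[/eqP->|/mapP[e]]] /=.
- by rewrite dotDl dotZl w11 yw; lra.
- by rewrite dotNr dotDl dotZl w11 yw; lra.
rewrite mem_filter => /andP[ea eL] -> /=.
by have := yL _ eL ea; rewrite dotBr dotZr !dotDl !dotZl w11 yw; lra.
Qed.

(** By symmetry no [a.2] is negative, and [a.2 = 0] would put [P] into a hyperplane, making its
    volume zero. So 0 satisfies all constraints strictly, and each irredundant one carries a
    facet. *)
Lemma polytope_facets n (P : set 'rV[R]_n) :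
  polytope P -> origin_symmetric P -> vol P <> 0%E ->
  exists2 L, P = half_spaces L &
    forall a, a \in L -> 0 < a.2 /\
      exists w r, sphere_support (surface_area P) w /\ a.1 = r *: w.
Proof.
move=> /polytope_polyhedral[L0 PL0] Psym vP.
have [L LL0 irr] := half_spaces_irredundant L0.
have PL : P = half_spaces L by rewrite LL0.
have PN x : P x -> P (- x) by move=> Px; rewrite Psym; exists x.
have [x Px] : P !=set0 by apply/set0P/eqP => P0; apply: vP; rewrite P0 vol_set0.
have a2_ge0 a : a \in L -> 0 <= a.2.
  move=> aL; have := PN _ Px; move: Px; rewrite PL => /(_ a aL) xa /(_ a aL).
  by rewrite dotNl; lra.
have a1_neq0 a : a \in L -> a.1 != 0.
  move=> aL; apply/eqP => a10; have [y ya _] := irr _ aL.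
  by have := a2_ge0 _ aL; move: ya; rewrite a10 dot0r; lra.
have a2_gt0 a : a \in L -> 0 < a.2.
  move=> aL; rewrite lt_neqAle eq_sym a2_ge0 // andbT; apply/eqP => a20.
  apply: vP; apply: (@vol_hyperplane _ _ _ a.1 0); first exact: a1_neq0.
  move=> y Py; have := PN _ Py; move: Py; rewrite PL => /(_ a aL) ya /(_ a aL).
  by rewrite dotNl; lra.
exists L => // a aL; split; first exact: a2_gt0.
have [y ya yL] := irr _ aL.
pose r := Num.sqrt (dot a.1 a.1).
have r2 : r ^+ 2 = dot a.1 a.1 by rewrite sqr_sqrtr // dot_ge0.
have r0 : 0 < r by rewrite sqrtr_gt0 dot_gt0 // a1_neq0.
have aw : a.1 = r *: (r^-1 *: a.1) by rewrite scalerA mulfV ?scale1r // gt_eqF.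
have w1 : usphere (r^-1 *: a.1).
  by rewrite /usphere /= dotZl dotZr -r2 expr2; field; rewrite gt_eqF.
exists (r^-1 *: a.1), r; split=> //; apply: facet_support => //; rewrite {1}PL.
exact: irredundant_facet ya yL w1 r0 aw.
Qed.

End Facets.

(** * Affine dimension as the rank of difference vectors *)

Section AffineDimension.
Context {R : realType} {V : vectType R}.
Implicit Types (A : set V) (W : {vspace V}).

(** Seen from [x0], an affine set is closed under scaling (combine with [x0]) and under sums (double
    the midpoint). *)
Lemma affine_span A x0 (X : seq V) w : affine_set A -> A x0 ->
  (forall v, v \in X -> A (x0 + v)) -> w \in <<X>>%VS -> A (x0 + w).
Proof.
move=> aA A0 As ws.
have AZ t v : A (x0 + v) -> A (x0 + t *: v).
  move=> Av; have := aA _ _ t Av A0.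
  by congr A; rewrite scalerDr addrAC -scalerDl addrC [t + _]addrC subrK scale1r addrC.
have AD v1 v2 : A (x0 + v1) -> A (x0 + v2) -> A (x0 + (v1 + v2)).
  move=> A1 A2; have /(AZ 2) : A (x0 + (2^-1 *: v1 + 2^-1 *: v2)).
    have half : 2^-1 + 2^-1 = 1 :> R by field.
    have := aA _ _ 2^-1 A1 A2; rewrite (_ : 1 - 2^-1 = 2^-1); last by lra.
    by congr A; rewrite !scalerDr addrACA -scalerDl half scale1r.
  by rewrite -scalerDr scalerA mulfV ?scale1r // pnatr_eq0.
rewrite (@coord_span _ _ _ (in_tuple X) _ ws); elim/big_rec: _ => [|i v _ Av]; first by rewrite addr0.
apply: AD => //; apply: AZ; apply: As.
by apply: mem_nth; rewrite ltn_ord.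
Qed.

Lemma aff_hull_span A x0 (X : seq V) : A x0 ->
  (forall v, v \in X -> A (x0 + v)) -> (forall x, A x -> x - x0 \in <<X>>%VS) ->
  aff_hull A = [set x0 + w | w in [set` <<X>>%VS]].
Proof.
move=> A0 As sA; apply/seteqP; split=> [x Ax|_ [w ws <-] C [aC AC]].
  apply: Ax; split=> [_ _ t [v vs <-] [w ws <-]|x' Ax']; last first.
    by exists (x' - x0); [exact: sA|rewrite addrC subrK].
  exists (t *: v + (1 - t) *: w); first by rewrite /= rpredD ?rpredZ.
  by rewrite !scalerDr addrACA -scalerDl (addrC t) subrK scale1r.
by apply: affine_span ws => //; [exact: AC|move=> v /As /AC].
Qed.

(** A coset determines its direction space, so whatever [xget] picks equals the span of [X]. *)
Lemma affdim_span A x0 (X : seq V) : A x0 ->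
  (forall v, v \in X -> A (x0 + v)) -> (forall x, A x -> x - x0 \in <<X>>%VS) ->
  affdim A = \dim <<X>>.
Proof.
move=> A0 As sA; have hE := aff_hull_span A0 As sA.
rewrite /affdim; set Ws := [set W | _]; have Ws0 : Ws <<X>>%VS by exists x0.
have [x xE] := xgetPex 0%VS (ex_intro _ _ Ws0); congr (\dim _).
move: (xget _ _) xE => W; rewrite hE => xE.
have [w0 w0W x0E] : [set x + w | w in [set` W]] x0.
  by rewrite -xE; exists 0; rewrite /= ?mem0v ?addr0.
apply/vspaceP => v; apply/idP/idP => [vW|vs].
  have [w ws wE] : [set x0 + w | w in [set` <<X>>%VS]] (x + (w0 + v)).
    by rewrite xE; exists (w0 + v) => //=; rewrite rpredD.
  by move: wE; rewrite addrA x0E => /addrI <-.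
have [w wW wE] : [set x + w | w in [set` W]] (x0 + v).
  by rewrite -xE; exists v.
have -> : v = w - w0.
  by apply: (addrI (x0 : V)); rewrite -wE -x0E -addrA [w0 + _]addrCA subrr addr0.
by rewrite rpredB.
Qed.

(** Differences spanning a space of maximal dimension are taken; no further difference can enlarge
    it. *)
Lemma affdim_spanned A x0 : A x0 ->
  exists2 X, (forall v, v \in X -> A (x0 + v)) & forall x, A x -> x - x0 \in <<X>>%VS.
Proof.
move=> A0; pose Q k := `[< exists2 X, (forall v, v \in X -> A (x0 + v)) &
  \dim <<X>> = k >].
have Q0 : exists k, Q k by exists 0%N; apply/asboolP; exists [::]; rewrite // span_nil dimv0.
have Qb k : Q k -> (k <= \dim (fullv : {vspace V}))%N.
  by move=> /asboolP[X _ <-]; apply: dimvS; exact: subvf.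
case: (ex_maxnP Q0 Qb) => k /asboolP[X sA sk] kmax; exists X => // x Ax.
have /kmax : Q (\dim <<x - x0 :: X>>).
  apply/asboolP; exists (x - x0 :: X) => // v; rewrite inE => /predU1P[->|/sA//].
  by rewrite addrC subrK.
rewrite -sk => le; have : (<<X>> <= <<x - x0 :: X>>)%VS.
  by rewrite span_cons addvSr.
move=> sub; have /eqP -> : (<<X>> == <<x - x0 :: X>>)%VS by rewrite eqEdim sub le.
by rewrite memv_span // mem_head.
Qed.

Lemma affdim0_eq A x y : affdim A = 0%N -> A x -> A y -> x = y.
Proof.
move=> A0 Ax Ay; have [X sA As] := affdim_spanned Ax.
move: A0; rewrite (affdim_span Ax sA As) => /eqP; rewrite dimv_eq0 => /eqP s0.
by have := As _ Ay; rewrite s0 memv0 subr_eq0 => /eqP.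
Qed.

Lemma affdim_set1 x : affdim [set x : V] = 0%N.
Proof.
rewrite (@affdim_span _ x [::]) ?span_nil ?dimv0 // => y ->.
by rewrite subrr mem0v.
Qed.

Lemma lin_span_eq A W : A `<=` [set` W] ->
  (forall W', A `<=` [set` W'] -> (W <= W')%VS) -> lin_span A = W.
Proof.
move=> AW minW; rewrite /lin_span; set Ws := [set W | _].
have [AW' minW'] : Ws (xget fullv Ws) by apply: (xgetPex fullv); exists W.
by apply/eqP; rewrite eqEsubv minW' // minW.
Qed.

End AffineDimension.

(** * Bases as matrices, basis exchange and common weights *)

Section Matroid.
Context {R : realType}.

Lemma mem_span_rows m n (f : 'I_m -> 'rV[R]_n) (X : seq 'rV[R]_n) v :
  X =i codom f -> (v \in <<X>>%VS) = (v <= \matrix_(i < m) f i)%MS.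
Proof.
move=> Xf; apply/idP/idP => [vX|/submxP[D ->]].
  rewrite (@coord_span _ _ _ (in_tuple X) _ vX); apply: summx_sub => i _.
  apply: scalemx_sub; have /codomP[j ->] : (in_tuple X)`_i \in codom f.
    by rewrite -Xf mem_nth // ltn_ord.
  by rewrite -(rowK f j) row_sub.
rewrite mulmx_sum_row memv_suml // => i _; rewrite rpredZ // rowK memv_span //.
by rewrite Xf codom_f.
Qed.

Variables (n N : nat) (u : 'I_N -> 'rV[R]_n).

Definition basis_mx (B : {set 'I_N}) : 'M[R]_(#|B|, n) :=
  \matrix_(i < #|B|) u (enum_val i).

Lemma sub_basis_mx (B : {set 'I_N}) k : k \in B -> (u k <= basis_mx B)%MS.
Proof.
move=> kB; rewrite -[in u k](enum_rankK_in kB kB).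
by rewrite -(rowK (fun i : 'I_#|B| => u (enum_val i))) row_sub.
Qed.

Lemma row_fullP m (A : 'M[R]_(m, n)) :
  reflect (forall v : 'rV[R]_n, (v <= A)%MS) (row_full A).
Proof.
apply: (iffP idP) => [fA v|vA]; first exact: submx_full.
by rewrite -sub1mx; apply/row_subP => i; exact: vA.
Qed.

Lemma matroid_basisE (B : {set 'I_N}) :
  matroid_basis u B = row_full (basis_mx B) && (#|B| <= n)%N.
Proof.
rewrite /matroid_basis basisEdim size_image dimvf /dim /= mul1n; congr (_ && _).
have sB v : (v \in <<[seq u i | i in B]>>%VS) = (v <= basis_mx B)%MS.
  apply: mem_span_rows => x; apply/fintype.imageP/codomP => [[i iB ->]|[i ->]].
    by exists (enum_rank_in iB i); rewrite enum_rankK_in.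
  by exists (enum_val i); rewrite ?enum_valP.
apply/subvP/row_fullP => h v; first by rewrite -sB h ?memvf.
by rewrite sB.
Qed.

(** With [matroid_basis_full] this makes [pinvmx (basis_mx B)] a two-sided inverse without a cast
    from [#|B|] to [n]; multiplying [u k] by it gives the coordinates in the basis [B]. *)
Lemma matroid_basis_free (B : {set 'I_N}) : matroid_basis u B ->
  basis_mx B *m pinvmx (basis_mx B) = 1%:M.
Proof.
rewrite matroid_basisE => /andP[/eqP rB Bn]; apply: mulmxVp.
by rewrite /row_free eqn_leq rank_leq_row rB.
Qed.

Lemma matroid_basis_full (B : {set 'I_N}) : matroid_basis u B ->
  pinvmx (basis_mx B) *m basis_mx B = 1%:M.
Proof. by rewrite matroid_basisE => /andP[fB _]; exact: mulVpmx. Qed.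

Lemma matroid_basis_exists : <<[seq u i | i : 'I_N]>>%VS = fullv ->
  exists B, matroid_basis u B.
Proof.
move=> u_span; pose A := \matrix_(i < N) u i.
have fA : row_full A.
  apply/row_fullP => v; rewrite -(@mem_span_rows _ _ _ [seq u i | i : 'I_N]) //.
  by rewrite u_span memvf.
pose f := fullrankfun fA; exists [set f i | i : 'I_n].
rewrite matroid_basisE; apply/andP; split; last first.
  by rewrite card_imset ?card_ord //; exact: fullrankfun_inj.
apply/row_fullP => v; apply: submx_trans (submx_full v (fullrowsub_full fA)) _.
apply/row_subP => i; rewrite row_rowsub rowK; apply: sub_basis_mx.
exact: imset_f.
Qed.

Variable c : 'I_N -> R.
Hypothesis c_basis : forall B B', matroid_basis u B -> matroid_basis u B' ->
  \sum_(i in B) c i = \sum_(i in B') c i.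

(** For [k] in [B] the coordinates form a unit vector. Otherwise [k] may replace [b = enum_val m] in
    the basis, and equality of the two weights leaves [c b = c k]. *)
Lemma basis_exchange (B : {set 'I_N}) k (m : 'I_#|B|) : matroid_basis u B ->
  (u k *m pinvmx (basis_mx B)) 0 m != 0 -> c (enum_val m) = c k.
Proof.
move=> bB; set G := pinvmx _; set la := u k *m G => lam.
have [kB|kB] := boolP (k \in B).
  move: lam; rewrite /la; have -> : u k = row (enum_rank_in kB k) (basis_mx B).
    by rewrite rowK enum_rankK_in.
  rewrite -row_mul matroid_basis_free // !mxE.
  have [<-|] := eqVneq (enum_rank_in kB k) m; first by rewrite enum_rankK_in.
  by rewrite eqxx.
pose b := enum_val m; have bBm : b \in B by exact: enum_valP.
pose B' := k |: (B :\ b).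
have ub : (u b <= basis_mx B')%MS.
  have ukE : u k = la *m basis_mx B by rewrite -mulmxA matroid_basis_full ?mulmx1.
  (* The expansion of [u k] in the basis is solved for [u b]. *)
  have -> : u b = (la 0 m)^-1 *:
      (u k - \sum_(i | i != m) la 0 i *: u (enum_val i)).
    rewrite {1}ukE mulmx_sum_row (bigD1 m) //= rowK.
    under eq_bigr do rewrite rowK.
    by rewrite addrK scalerA mulVf // scale1r.
  apply: scalemx_sub; apply: addmx_sub.
    by apply: sub_basis_mx; rewrite setU11.
  rewrite eqmx_opp; apply: summx_sub => i im; apply: scalemx_sub.
  apply: sub_basis_mx; rewrite !inE enum_valP andbT; apply/orP; right.
  by apply: contra_neq im => /enum_val_inj.
have kB' : k \notin B :\ b by rewrite !inE negb_and kB orbT.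
have bB' : matroid_basis u B'.
  move: bB; rewrite !matroid_basisE => /andP[fB Bn]; apply/andP; split.
    apply/row_fullP => v; apply: submx_trans (submx_full v fB) _.
    apply/row_subP => i; rewrite rowK; have [->//|im] := eqVneq (enum_val i) b.
    by apply: sub_basis_mx; rewrite !inE im enum_valP orbT.
  by rewrite cardsU1 kB' (leq_trans _ Bn) // (cardsD1 b B) bBm.
have := c_basis bB bB'; rewrite (big_setD1 b) //= (big_setU1 _ kB') /=.
by move=> /addIr.
Qed.

(* A weight that all bases share is constant on the connected components of
   the matroid, so the sum of the components of weight [a] is a direct summand;
   [Q] is the projection onto it. *)
Lemma component_projection (a : R) : (exists B, matroid_basis u B) ->
  exists Q : 'M[R]_n, forall k, u k *m Q = (c k == a)%:R *: u k.
Proof.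
case=> B bB; pose G := pinvmx (basis_mx B).
pose D := diag_mx (\row_(m < #|B|) (c (enum_val m) == a)%:R : 'rV[R]_#|B|).
exists (G *m D *m basis_mx B) => k.
rewrite (mulmxA (u k)) (mulmxA (u k)).
(* All nonzero coordinates of [u k] sit at basis elements of weight [c k], so [D] keeps all of them
   or none. *)
have -> : u k *m G *m D = (c k == a)%:R *: (u k *m G).
  apply/rowP => m; rewrite mul_mx_diag [LHS]mxE [RHS]mxE [X in _ * X]mxE mulrC.
  have [->|lam] := eqVneq ((u k *m G) 0 m) 0; first by rewrite !mulr0.
  by rewrite (basis_exchange bB lam).
by rewrite -scalemxAl -mulmxA matroid_basis_full ?mulmx1.
Qed.

(** In the basis [B] the matrix [Q] is diagonal with entries [c i], while its trace does not depend
    on [B]. *)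
Lemma basis_trace (Q : 'M[R]_n) (B : {set 'I_N}) : matroid_basis u B ->
  (forall k, u k *m Q = c k *: u k) -> \tr Q = \sum_(i in B) c i.
Proof.
move=> bB uQ; pose G := pinvmx (basis_mx B).
pose D := diag_mx (\row_(m < #|B|) c (enum_val m)).
have UQ : basis_mx B *m Q = D *m basis_mx B.
  by apply/row_matrixP => m; rewrite !row_mul rowK uQ row_diag_mx -scalemxAl -rowE rowK mxE.
have -> : Q = G *m (D *m basis_mx B).
  by rewrite -UQ mulmxA matroid_basis_full ?mul1mx.
rewrite mxtrace_mulC -mulmxA matroid_basis_free // mulmx1 mxtrace_diag.
by under eq_bigr do rewrite mxE; rewrite [RHS]big_enum_val.
Qed.

End Matroid.

(** * Dimension of the matroid polytope from the block structure *)

Section MatroidPolytope.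
Context {R : realType}.

(** The differences of vertices span the kernel of the map [f] taking block sums, which is onto an
    [l]-dimensional space. They lie in the kernel by the block counts; conversely, a functional
    vanishing on them is a common weight, hence constant on blocks, hence zero on the kernel. *)
Lemma matroid_polytope_dim (n N l : nat) (u : 'I_N -> 'rV[R]_n) (sg : 'I_N -> 'I_l)
    (h : 'I_l -> R) :
  (exists B, matroid_basis u B) ->
  (forall j, exists i, sg i = j) ->
  (forall B j, matroid_basis u B -> \sum_(i in B) (sg i == j)%:R = h j) ->
  (forall c : 'I_N -> R,
    (forall B B', matroid_basis u B -> matroid_basis u B' ->
       \sum_(i in B) c i = \sum_(i in B') c i) ->
    forall i k, sg i = sg k -> c i = c k) ->
  (affdim (matroid_polytope u) + l = N)%N.
Proof.
move=> [B0 bB0] sg_surj sg_basis sg_const.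
pose e (B : {set 'I_N}) : 'rV[R]_N := \sum_(i in B) delta_mx 0 i.
have eE B i : e B 0 i = (i \in B)%:R.
  rewrite summxE; have [iB|iB] := boolP (i \in B).
    rewrite (bigD1 i) //= big1 ?mxE ?eqxx ?addr0 // => j /andP[_ /negPf ji].
    by rewrite mxE eq_sym ji.
  rewrite big1 // => j jB; rewrite mxE eqxx /=; case: eqVneq => // ij.
  by rewrite ij jB in iB.
have e_sum B (c : 'I_N -> R) : \sum_i e B 0 i * c i = \sum_(i in B) c i.
  rewrite [RHS]big_mkcond; apply: eq_bigr => i _; rewrite eE.
  by case: (i \in B); rewrite ?mul1r ?mul0r.
pose X := [seq e B - e B0 | B <- enum [set B | matroid_basis u B]%SET].
have memX B : matroid_basis u B -> e B - e B0 \in X.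
  by move=> bB; apply/mapP; exists B; rewrite // mem_enum inE.
have XP v : v \in X -> exists2 B, matroid_basis u B & v = e B - e B0.
  by case/mapP=> B; rewrite mem_enum inE; exists B.
have vertex B : matroid_basis u B -> matroid_polytope u (e B).
  by move=> bB C [_ SC]; apply: SC; exists B.
rewrite (@affdim_span _ _ _ (e B0) X); first last.
- move=> x Px; apply: (Px [set x | x - e B0 \in <<X>>%VS]); split; last first.
    by move=> _ [B bB <-]; apply: memv_span; exact: memX.
  apply/convex_setP => y z t _ /= yX zX.
  have -> : t *: y + (1 - t) *: z - e B0 = t *: (y - e B0) + (1 - t) *: (z - e B0).
    by apply/rowP => i; rewrite !mxE; ring.
  by rewrite rpredD // rpredZ.
- by move=> v /XP[B bB ->]; rewrite addrC subrK; exact: vertex.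
- exact: vertex.
pose M : 'M[R]_(N, l) := \matrix_(i, j) (sg i == j)%:R.
pose f := linfun (mulmxr M : 'rV[R]_N -> 'rV[R]_l).
have fE w j : f w 0 j = \sum_i w 0 i * (sg i == j)%:R.
  by rewrite lfunE /= mxE; apply: eq_bigr => i _; rewrite mxE.
have f_onto : limg f = fullv.
  apply/eqP; rewrite eqEsubv subvf; apply/subvP => v _.
  rewrite (row_sum_delta v) memv_suml // => j _; rewrite rpredZ //.
  have [i ij] := sg_surj j; apply/memv_imgP; exists (delta_mx 0 i); rewrite ?memvf //.
  apply/rowP => k; rewrite fE (bigD1 i) //= big1 => [|i' /negPf ii'].
    by rewrite !mxE !eqxx addr0 mul1r ij eq_sym.
  by rewrite mxE ii' andbF mul0r.
have := limg_ker_dim f fullv; rewrite capfv f_onto !dimvf /dim /= !mul1n => dimE.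
apply: etrans dimE; congr (\dim _ + _)%N; apply/eqP; rewrite eqEsubv; apply/andP; split.
  apply/span_subvP => v /XP[B bB ->]; rewrite memv_ker linearB /= subr_eq0.
  by apply/eqP/rowP => j; rewrite !fE !e_sum !sg_basis.
apply/subvP => w; rewrite memv_ker => /eqP fw.
pose A := \matrix_(i < size X) X`_i.
rewrite (@mem_span_rows _ _ _ (fun i : 'I_(size X) => X`_i)); last first.
  move=> v; apply/idP/codomP => [vX|[i ->]]; last by rewrite mem_nth.
  have iX : (index v X < size X)%N by rewrite index_mem.
  by exists (Ordinal iX); rewrite nth_index.
rewrite submxE -/A; apply/eqP/rowP => j; rewrite mxE [RHS]mxE.
(* The columns of [cokermx A] test membership in the row space of [A]; each one vanishes on [X] and
   is thus a weight that all bases share. *)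
pose c i := cokermx A i j.
have cX v : v \in X -> \sum_i v 0 i * c i = 0.
  move=> vX; have iX : (index v X < size X)%N by rewrite index_mem.
  have := mulmx_coker A; move/matrixP/(_ (Ordinal iX) j).
  rewrite mxE [RHS]mxE => AX; rewrite -[RHS]AX; apply: eq_bigr => i _.
  by rewrite mxE /= nth_index.
have c_basis B : matroid_basis u B -> \sum_(i in B) c i = \sum_(i in B0) c i.
  move=> /memX/cX; under eq_bigr do rewrite mxE [(- e B0) _ _]mxE mulrBl.
  by rewrite sumrB !e_sum => /eqP; rewrite subr_eq0 => /eqP.
have c_sg := sg_const c (fun B B' bB bB' => etrans (c_basis B bB) (esym (c_basis B' bB'))).
rewrite (partition_big sg predT) //= big1 // => k _.
have [i0 i0k] := sg_surj k.
transitivity (f w 0 k * c i0); last by rewrite fw mxE mul0r.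
rewrite fE mulr_suml big_mkcond; apply: eq_bigr => i _.
have [ik|_] := eqVneq (sg i) k; last by rewrite mulr0 mul0r.
by rewrite mulr1; congr (_ * _); apply: c_sg; rewrite ik.
Qed.

End MatroidPolytope.

(** * Faces and summands of a direct Minkowski sum *)

Section DirectSum.
Context {R : realType} {n l : nat}.

Lemma direct_projections (xi : 'I_l -> {vspace 'rV[R]_n}) :
  directv (\sum_i xi i)%VS -> (\sum_i xi i)%VS = fullv ->
  exists pi : 'I_l -> 'End('rV[R]_n),
    [/\ forall i x, pi i x \in xi i,
        forall x, \sum_i pi i x = x
      & forall y j, (forall i, y i \in xi i) -> pi j (\sum_i y i) = y j].
Proof.
move=> dxi xi_full; exists (sumv_pi_for (esym xi_full)).
have pi_mem i x := memv_sum_pi (esym xi_full) i x.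
have pi_sum x := sumv_pi_sum (esym xi_full) (memvf x).
split=> // y j y_mem; apply/eqP.
have := directv_sum_unique dxi (fun i => sumv_pi_for (esym xi_full) i (\sum_i y i)) y
  (fun i _ => pi_mem i _) (fun i _ => y_mem i).
by rewrite pi_sum eqxx => /esym/forallP/(_ j).
Qed.

Variables (P : set 'rV[R]_n) (Ps : 'I_l -> set 'rV[R]_n).
Variable xi : 'I_l -> {vspace 'rV[R]_n}.
Variable pi : 'I_l -> 'End('rV[R]_n).
Hypothesis pi_mem : forall i x, pi i x \in xi i.
Hypothesis pi_sum : forall x, \sum_i pi i x = x.
Hypothesis pi_eq : forall y j, (forall i, y i \in xi i) -> pi j (\sum_i y i) = y j.
Hypothesis P_sum : P = minkowski_sum Ps.
Hypothesis Ps_sub : forall i, Ps i `<=` [set` xi i].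

Lemma proj_id i j x : x \in xi j -> pi i x = if i == j then x else 0.
Proof.
move=> xj; pose y k := if k == j then x else 0.
have yE : x = \sum_k y k.
  rewrite (bigD1 j) //= /y eqxx big1 ?addr0 // => k /negPf ->.
  by [].
rewrite {1}yE pi_eq // => k; rewrite /y; case: eqVneq => [->//|_].
exact: mem0v.
Qed.

Lemma summand_proj i x : P x -> Ps i (pi i x).
Proof.
rewrite P_sum => -[y Py ->]; rewrite pi_eq // => j; exact: Ps_sub.
Qed.

(** The components of a point of a Minkowski sum vary independently. *)
Lemma sum_swap i x y : P x -> Ps i y -> P (x - pi i x + y).
Proof.
move=> Px Py; rewrite P_sum; exists (fun j => if j == i then y else pi j x).
  by move=> j; case: eqVneq => [->//|_]; exact: summand_proj.
rewrite [RHS](bigD1 i) //= eqxx addrC; congr (_ + _).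
apply/eqP; rewrite subr_eq -{1}(pi_sum x) (bigD1 i) //= addrC.
apply/eqP; congr (_ + _); by apply: eq_bigr => j /negPf ->.
Qed.

(* If [w] is orthogonal to neither [xi j1] nor [xi j2], then on the face with
   normal [w] not only [dot x w] but also [dot (pi j1 x) w] is constant. *)
Lemma face_prism_null (w x1 x2 : 'rV[R]_n) j1 j2 :
  usphere w -> j1 != j2 -> x1 \in xi j1 -> x2 \in xi j2 ->
  dot x1 w != 0 -> dot x2 w != 0 -> hyperplane_vol w (face P w) = 0%E.
Proof.
move=> w1 j12 x1j x2j x1w x2w; have {}w1 : dot w w = 1 by [].
have [f0|/set0P[p [Pp pmax]]] := eqVneq (face P w) set0.
  rewrite /hyperplane_vol (_ : [set _ | _] = set0) ?vol_set0 //.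
  by apply/seteqP; split=> // z [x [t []]]; rewrite f0.
have [q qE] : exists q, forall x, dot (pi j1 x) w = dot x q.
  by apply: linear_dot => a x y; rewrite linearP dotDl dotZl.
have le_face x y : face P w x -> P y -> dot (pi j1 y) w <= dot (pi j1 x) w.
  move=> [Px xmax] Py; have := xmax _ (sum_swap Px (summand_proj j1 Py)).
  by rewrite dotDl dotBl; lra.
(* Subtracting the part of [q] along [w] makes the functional constant along the prism. The result
   is nonzero: [q] vanishes at [x2] while [w] does not, so [q] parallel to [w] would give [q = 0],
   contradicting its value at [x1]. *)
apply: (@vol_hyperplane _ _ _ (q - dot w q *: w) (dot p q - dot w q * dot p w)).
  apply/eqP => /eqP; rewrite subr_eq0 => /eqP qw.
  have := qE x2; rewrite (proj_id _ x2j) (negPf j12) dot0l qw dotZr => /esym/eqP.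
  rewrite mulf_eq0 (negPf x2w) orbF => /eqP wq0.
  have := qE x1; rewrite (proj_id _ x1j) eqxx qw wq0 scale0r dot0r => /eqP.
  by rewrite (negPf x1w).
move=> z [x [t [[Px xmax] _ ->]]].
have xw : dot x w = dot p w.
  by apply/eqP; rewrite eq_le pmax //= xmax.
have xq : dot x q = dot p q.
  rewrite -!qE; apply/eqP; rewrite eq_le !le_face //.
by rewrite dotDl dotZl !dotBr !dotZr w1 xw xq; ring.
Qed.

(** Some component of [w] is not orthogonal to [w]. Failing orthogonality to a second subspace is
    also an open condition, so both would hold at a nearby facet normal, against
    [face_prism_null]. *)
Lemma support_block w : sphere_support (surface_area P) w ->
  exists j, forall i x, i != j -> x \in xi i -> dot x w = 0.
Proof.
move=> w_supp; have w1 : dot w w = 1 by case: w_supp.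
have [j wj] : exists j, dot (pi j w) w != 0.
  apply: contrapT => /forallNP wj0.
  have : dot (\sum_i pi i w) w = 0.
    rewrite dot_suml big1 // => j _.
    by apply/eqP; apply: contrapT => /negP; exact: wj0.
  by rewrite pi_sum w1; apply/eqP/oner_neq0.
exists j => i x ij xi_x; apply/eqP/negPn/negP => xw.
have near_neq0 (y : 'rV[R]_n) : dot y w != 0 -> nbhs w [set v | dot y v != 0].
  move=> yw; have : \forall v \near w, dot v y != 0.
    by apply: cvgr_neq0 (@dot_continuous _ _ y w) _; rewrite dotC.
  by apply: filterS => v /=; rewrite dotC.
have [v [jv xv] [v1]] := support_facet w_supp (filterI (near_neq0 _ wj) (near_neq0 _ xw)).
by apply; apply: (face_prism_null v1 _ (pi_mem j w) xi_x jv xv); rewrite eq_sym.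
Qed.

Hypothesis P_sym : origin_symmetric P.
Hypothesis Ps_convex : forall i, convex_set (Ps i : set (convex_lmodType 'rV[R]_n)).
Hypothesis P_ne : P !=set0.

(** Symmetry puts 0 into every summand, as the midpoint of the components of [p] and [- p]; the
    other components of a point of [Ps j] can then be taken to be 0. *)
Lemma summandP j x : Ps j x <-> P x /\ x \in xi j.
Proof.
have PN y : P y -> P (- y) by move=> Py; rewrite P_sym; exists y.
have [p Pp] := P_ne.
have Ps0 i : Ps i 0.
  have /convex_setP cPs := @Ps_convex i.
  have : 0 <= (2^-1 : R) <= 1 by lra.
  move=> /cPs/(_ (summand_proj i Pp) (summand_proj i (PN _ Pp))).
  by rewrite linearN scalerN -scalerBl (_ : _ - _ = 0) ?scale0r //; lra.
split=> [Px|[Px xj]]; last first.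
  by have := summand_proj j Px; rewrite (proj_id _ xj) eqxx.
split; last exact: Ps_sub.
rewrite P_sum; exists (fun i => if i == j then x else 0).
  by move=> i; case: eqVneq => [->//|_].
by rewrite (bigD1 j) //= eqxx big1 ?addr0 // => k /negPf ->.
Qed.

End DirectSum.

(** * Blocks of normals and indecomposability of the summands *)

Section Blocks.
Context {R : realType} {n N l : nat}.

Lemma half_spaces_absorbing (L : seq ('rV[R]_n * R)) x :
  (forall a, a \in L -> 0 < a.2) ->
  exists2 e, 0 < e & half_spaces L (e *: x).
Proof.
(* Covering all [t] up to [e] lets the induction shrink [e] for each new constraint. *)
move=> L0; suff [e e0 eL] : exists2 e, 0 < e &
    forall t, 0 <= t <= e -> half_spaces L (t *: x).
  by exists e => //; apply: eL; rewrite lexx ltW.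
elim: L L0 => [|b L IH] L0; first by exists 1.
have [|e e0 eL] := IH; first by move=> a aL; apply: L0; rewrite inE aL orbT.
have b0 : 0 < b.2 by apply: L0; rewrite mem_head.
have xb0 : 0 < `|dot x b.1| + 1 by rewrite ltr_wpDl.
exists (Num.min e (b.2 / (`|dot x b.1| + 1))) => [|t /andP[t0]].
  by rewrite lt_min e0 divr_gt0.
rewrite le_min => /andP[te tb] a; rewrite inE => /predU1P[->|aL]; last first.
  by apply: eL => //; rewrite t0.
rewrite dotZl; move: tb; rewrite ler_pdivlMr //; apply: le_trans.
by rewrite ler_wpM2l // (le_trans (ler_norm _)) // lerDl.
Qed.

Variables (u : 'I_N -> 'rV[R]_n) (xi : 'I_l -> {vspace 'rV[R]_n}).
Variable pi : 'I_l -> 'End('rV[R]_n).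
Variable sg : 'I_N -> 'I_l.
Hypothesis u_neq0 : forall k, u k != 0.
Hypothesis u_span : <<[seq u i | i : 'I_N]>>%VS = fullv.
Hypothesis pi_mem : forall i x, pi i x \in xi i.
Hypothesis pi_sum : forall x, \sum_i pi i x = x.
Hypothesis sg_orth : forall k i x, i != sg k -> x \in xi i -> dot x (u k) = 0.

Lemma dot_span_eq x y : (forall k, dot x (u k) = dot y (u k)) -> x = y.
Proof.
move=> xy; apply/eqP; rewrite -subr_eq0 -dot_eq0.
have : x - y \in <<[seq u i | i : 'I_N]>>%VS by rewrite u_span memvf.
move=> /(@coord_span _ _ _ (in_tuple _)) {2}->; rewrite dotC dot_suml big1 // => i _.
have /codomP[k ->] : (in_tuple [seq u i | i : 'I_N])`_i \in codom u.
  by rewrite mem_nth // ltn_ord.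
by rewrite dotZl dotC dotBl xy subrr mulr0.
Qed.

Lemma dot_proj i x k : dot (pi i x) (u k) = (sg k == i)%:R * dot x (u k).
Proof.
have [<-|ki] := eqVneq (sg k) i; last by rewrite mul0r (sg_orth _ (pi_mem i x)) // eq_sym.
rewrite mul1r -{2}(pi_sum x) dot_suml (bigD1 (sg k)) //= big1 ?addr0 // => j jk.
exact: sg_orth jk (pi_mem j x).
Qed.

(** The adjoint of [pi i] has every [u k] as eigenvector, with eigenvalue 0 or 1; [basis_trace] then
    counts the block. *)
Lemma proj_adjoint i : exists Q : 'M[R]_n, forall k, u k *m Q = (sg k == i)%:R *: u k.
Proof.
exists (lin1_mx (pi i))^T => k; apply/eqP; rewrite -subr_eq0 -dot_eq0.
set d := _ - _; rewrite {2}/d dotBr dot_mulmx trmxK mul_rV_lin1 dot_proj.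
by rewrite dotZr subrr.
Qed.

Lemma block_nonzero i x : x \in xi i -> x != 0 -> exists k, sg k = i.
Proof.
move=> xi_x x0; apply: contrapT => /forallNP nk; move/eqP: x0; apply.
apply: dot_span_eq => k; rewrite dot0l; apply: sg_orth xi_x.
by apply/eqP => /esym; exact: nk.
Qed.

Variables (P : set 'rV[R]_n) (K : set 'rV[R]_n) (L : seq ('rV[R]_n * R)).
Variable j : 'I_l.
Hypothesis P_L : P = half_spaces L.
Hypothesis L_gt0 : forall a, a \in L -> 0 < a.2.
Hypothesis L_normal : forall a, a \in L -> exists k r, a.1 = r *: u k.
Hypothesis KP : forall x, K x <-> P x /\ x \in xi j.
Hypothesis K_compact : compact K.
Hypothesis K_convex : convex_set (K : set (convex_lmodType 'rV[R]_n)).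

Lemma block_absorbing x : x \in xi j -> exists2 e, 0 < e & K (e *: x).
Proof.
move=> xj; have [e e0 eL] := half_spaces_absorbing x L_gt0.
by exists e => //; apply/KP; rewrite P_L rpredZ.
Qed.

Lemma lin_span_block : lin_span K = xi j.
Proof.
apply: lin_span_eq => [x /KP[]//|W KW]; apply/subvP => x /block_absorbing[e e0 /KW /=].
by rewrite rpredZeq gt_eqF.
Qed.

Lemma closed_orthogonal (D : 'I_N -> Prop) :
  closed [set x : 'rV[R]_n | forall k, D k -> dot x (u k) = 0].
Proof.
rewrite (_ : [set x | _] = \bigcap_(k in D) ((fun x => dot x (u k)) @^-1` [set 0])) //.
apply: closed_bigI => k _; apply: preimage_closed; last exact: closed_eq.
by move=> x _; exact: dot_continuous.
Qed.

(** If [c i] and [c k] differ, the adjoint [T] of the projection onto the component of weight [c i]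
    splits [K] into its part in the image of [T] and its part in the kernel, both of positive
    dimension. *)
Lemma indecomposable_block (c : 'I_N -> R) :
  directly_indecomposable (lin_span K) K -> (exists B, matroid_basis u B) ->
  (forall B B', matroid_basis u B -> matroid_basis u B' ->
     \sum_(i in B) c i = \sum_(i in B') c i) ->
  forall i k, sg i = j -> sg k = j -> c i = c k.
Proof.
move=> K_indec u_basis c_basis i k ij kj; apply/eqP/negPn/negP => cik.
have [Q QE] := component_projection c_basis (c i) u_basis.
pose T (x : 'rV[R]_n) := x *m Q^T.
have TE x m : dot (T x) (u m) = (c m == c i)%:R * dot x (u m).
  by rewrite -dot_mulmx QE dotZr.
have T_xi x : x \in xi j -> T x \in xi j.
  (* A vector is determined by its products with the [u m], on which [T] and [pi j] both act by
     factors 0 or 1. *)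
  move=> xj; suff -> : T x = pi j (T x) by [].
  apply: dot_span_eq => m; rewrite dot_proj TE.
  have [_|mj] := eqVneq (sg m) j; first by rewrite mul1r.
  by rewrite (sg_orth _ xj) ?mulr0 // eq_sym.
(* Each constraint involves one product [dot x (u m)], which is either kept or replaced by 0, and
   [0 < a.2]. *)
have T_P x : P x -> P (T x) /\ P (x - T x).
  rewrite P_L => xL; split=> a aL; have := xL a aL; have := L_gt0 aL;
    have [m [r ->]] := L_normal aL; rewrite ?dotBl !dotZr TE; case: (c m == c i);
    rewrite ?mul1r ?mul0r; lra.
(* [X true] is the kernel of [T] and [X false] its image. *)
pose D (b : bool) m := (c m == c i) = b.
pose X b := [set x : 'rV[R]_n | forall m, D b m -> dot x (u m) = 0].
have T_X x : X true (x - T x) /\ X false (T x).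
  by split=> m; rewrite /D ?dotBl TE => ->; rewrite ?mul1r ?subrr ?mul0r.
have X0 x : X true x -> X false x -> x = 0.
  move=> x0 x1; apply: dot_span_eq => m; rewrite dot0l.
  by case: (eqVneq (c m) (c i)) => [/eqP|/negPf] ?; [exact: x0|exact: x1].
have X_T x : X false x -> T x = x.
  move=> xX; apply: dot_span_eq => m; rewrite TE.
  by case: eqVneq => [|/negPf mi]; rewrite ?mul1r // mul0r [RHS]xX.
have XT x : X true x -> T x = 0.
  move=> xX; apply: dot_span_eq => m; rewrite TE dot0l.
  by case: eqVneq => [/eqP mi|]; rewrite ?mul0r // mul1r [LHS]xX.
pose F : 'End('rV[R]_n) := linfun (mulmxr Q^T).
have FE x : F x = T x by rewrite lfunE.
(* [ord0] indexes the image of [T] and [ord_max] its kernel, whence the negation in [X (~~ s b)]. *)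
pose s (b : 'I_2) := b == ord0.
pose Y (b : 'I_2) := if s b then (F @: xi j)%VS else (xi j :&: lker F)%VS.
have YP b x : (x \in Y b) <-> x \in xi j /\ X (~~ s b) x.
  rewrite /Y; case: (s b) => /=; split.
  - by case/memv_imgP=> y yj ->; rewrite FE; split; [exact: T_xi|have [] := T_X y].
  - by case=> xj /X_T xT; apply/memv_imgP; exists x; rewrite // FE.
  - rewrite memv_cap memv_ker FE => /andP[xj /eqP Tx]; split=> //.
    by have [] := T_X x; rewrite Tx subr0.
  - by case=> xj /XT xT; rewrite memv_cap xj memv_ker FE xT eqxx.
have sumE (V : nmodType) (y : 'I_2 -> V) : \sum_b y b = y ord0 + y ord_max.
  rewrite big_ord_recl big_ord1; congr (_ + y _); exact: val_inj.
have K_P x : K x -> P x by move=> /KP[].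
have K_xi x : K x -> x \in xi j by move=> /KP[].
have split_K : direct_sum (lin_span K) K (fun b => K `&` X (~~ s b)).
  split.
    apply/seteqP; split=> [x Kx|_ [y Ky ->]].
      have [PT PT'] := T_P _ (K_P _ Kx); have [XT' XT''] := T_X x.
      exists (fun b => if s b then T x else x - T x); last first.
        by rewrite sumE /= addrC subrK.
      move=> b; case: (s b); split=> //; apply/KP; split=> //.
        exact: T_xi (K_xi _ Kx).
      by rewrite rpredB ?T_xi // K_xi.
    (* In each constraint one of the two summands contributes 0, so the sum inherits the bound of
       the other. *)
    have [[K0 X0'] [K1 X1']] := (Ky ord0, Ky ord_max).
    rewrite sumE; apply/KP; split; last by rewrite rpredD // K_xi.
    have := K_P _ K0; have := K_P _ K1; rewrite P_L => y1L y0L a aL.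
    have := y1L a aL; have := y0L a aL; have [m [r ->]] := L_normal aL.
    rewrite dotDl !dotZr.
    have [mi|mi] := eqVneq (c m) (c i).
      by rewrite (X1' m) ?mulr0 ?addr0 // /D mi eqxx.
    by rewrite (X0' m) ?mulr0 ?add0r // /D (negPf mi).
  exists Y; split.
  - apply/directv_sum_independent => y Yy y0.
    have yX b := (YP b (y b)).1 (Yy b isT).
    have y01 : y ord0 = - y ord_max.
      by apply/eqP; rewrite -addr_eq0 -sumE y0.
    have y1 : y ord_max = 0.
      apply: X0; first by have [] := yX ord_max.
      have [_ y0X] := yX ord0 => m Dm; have := y0X m Dm.
      by rewrite y01 dotNl => /eqP; rewrite oppr_eq0 => /eqP.
    move=> b _; case: (unliftP ord0 b) => [b'|] ->; last by rewrite y01 y1 oppr0.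
    by rewrite -y1; congr y; apply: val_inj; rewrite (ord1 b').
  - rewrite lin_span_block; apply/eqP; rewrite eqEsubv; apply/andP; split.
      by apply/subv_sumP => b _; apply/subvP => x /YP[].
    apply/subvP => x xj; have [XT' XT''] := T_X x.
    rewrite -(subrK (T x) x) addrC; apply/memv_sumP.
    exists (fun b => if s b then T x else x - T x); last by rewrite sumE.
    move=> b _; apply/YP; case: (s b); split=> //; first exact: T_xi.
    by rewrite rpredB ?T_xi.
  - move=> b; split.
    + exact: (compact_closedI K_compact (@closed_orthogonal (D (~~ s b)))).
    + move/convex_setP: K_convex => cK; apply/convex_setP => x y t t01 [Kx Xx] [Ky Xy].
      split; first exact: cK.
      by move=> m Dm; rewrite dotDl !dotZl Xx // Xy // !mulr0 addr0.
    + by move=> x [/K_xi xj Xx] /=; apply/YP.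
have summand_ne0 b m x : sg m = j -> x \in xi j -> X (~~ s b) x -> dot x (u m) != 0 ->
    affdim (K `&` X (~~ s b)) != 0%N.
  move=> mj xj Xx xm; apply/eqP => /affdim0_eq K0.
  have [e e0 Ke] := block_absorbing xj; have [e' _] := block_absorbing (mem0v (xi j)).
  rewrite scaler0 => K00.
  have /K0 : (K `&` X (~~ s b)) (e *: x).
    by split=> // q Dq; rewrite dotZl Xx ?mulr0.
  move=> /(_ 0) ex0; move: xm; rewrite -(mulrI_eq0 _ (lregP (lt0r_neq0 e0))) -dotZl.
  by rewrite ex0 ?dot0l ?eqxx //; split=> // q _; rewrite dot0l.
have uu m : sg m = j -> dot (pi j (u m)) (u m) != 0.
  by move=> mj; rewrite dot_proj mj eqxx mul1r dot_eq0.
(* The image part of [pi j (u i)] and the kernel part of [pi j (u k)] show that neither piece is a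
   point. *)
have [T0 T1] := (T_X (pi j (u k)), T_X (pi j (u i))).
case: (K_indec _ split_K) => /eqP; apply/negP.
- apply: (summand_ne0 ord0 i (T (pi j (u i)))) => //; first exact: T_xi.
    by case: T1.
  by rewrite TE eqxx mul1r uu.
- apply: (summand_ne0 ord_max k (pi j (u k) - T (pi j (u k)))) => //.
  + by rewrite rpredB ?T_xi.
  + by case: T0.
  + by rewrite dotBl TE [c k == _]eq_sym (negPf cik) mul0r subr0 uu.
Qed.

End Blocks.

Theorem theorem4p11 (R : realType) (n N : nat) (hn : (0 < n)%N)
    (u : 'I_N -> 'rV[R]_n)
    (u_unit : forall i, usphere (u i))
    (u_nonparallel : forall i j, i != j -> forall c : R, u i <> c *: u j)
    (u_span : <<[seq u i | i : 'I_N]>>%VS = fullv)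
    (P : set 'rV[R]_n)
    (P_polytope : polytope P)
    (P_sym : origin_symmetric P)
    (P_supp : sphere_support (surface_area P) =
              [set v | exists i, v = u i \/ v = - u i])
    (P_vol : vol P = n%:R%:E)
    (l : nat) (Ps : 'I_l -> set 'rV[R]_n)
    (P_sum : direct_sum fullv P Ps)
    (Ps_dim : forall i, (0 < affdim (Ps i))%N)
    (Ps_indec : forall i, directly_indecomposable (lin_span (Ps i)) (Ps i)) :
  (affdim (matroid_polytope u))%:Z = N%:Z - l%:Z.
Proof.
have vP : vol P <> 0%E by rewrite P_vol => -[] /eqP; rewrite pnatr_eq0 => /eqP n0; rewrite n0 in hn.
have [P_mink [xi [xi_direct xi_full Ps_xi]]] := P_sum.
have [pi [pi_mem pi_sum pi_eq]] := direct_projections xi_direct xi_full.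
have P_ne : P !=set0 by apply/set0P/eqP => P0; apply: vP; rewrite P0 vol_set0.
have Ps_sub i : Ps i `<=` [set` xi i] by case: (Ps_xi i).
have Ps_convex i : convex_set (Ps i : set (convex_lmodType 'rV[R]_n)).
  by case: (Ps_xi i).
have Ps_compact i : compact (Ps i) by case: (Ps_xi i).
have PsP := summandP pi_eq P_mink Ps_sub P_sym Ps_convex P_ne.
have u_neq0 k : u k != 0.
  by rewrite -dot_eq0 (_ : dot _ _ = 1) ?oner_neq0 //; exact: u_unit.
have u_supp k : sphere_support (surface_area P) (u k) by rewrite P_supp; exists k; left.
have [sg sg_orth] := choice (fun k =>
  support_block pi_mem pi_sum pi_eq P_mink Ps_sub (u_supp k)).
have sg_surj j : exists k, sg k = j.
  (* If [xi j] were zero, [Ps j] would be the single point 0, of dimension 0. *)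
  have xi0 : vpick (xi j) != 0.
    rewrite vpick0; apply/eqP => xi0; have := Ps_dim j.
    have Ps_eq0 y : Ps j y -> y = 0.
      by move=> /Ps_sub /=; rewrite xi0 memv0 => /eqP.
    rewrite (_ : Ps j = [set 0]) ?affdim_set1 //.
    apply/seteqP; split=> [y /Ps_eq0 //|_ ->]; have [p Pp] := P_ne.
    have Pj := summand_proj pi_eq P_mink Ps_sub j Pp.
    by rewrite -(Ps_eq0 _ Pj).
  exact: (block_nonzero u_span sg_orth (memv_pick _) xi0).
have [L PL L_facet] := polytope_facets P_polytope P_sym vP.
have L_gt0 a : a \in L -> 0 < a.2 by move=> /L_facet[].
have L_normal a : a \in L -> exists k r, a.1 = r *: u k.
  move=> /L_facet[_ [w [r [w_supp ->]]]]; move: w_supp; rewrite P_supp => -[k [->|->]].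
    by exists k, r.
  by exists k, (- r); rewrite scalerN scaleNr.
have u_basis := matroid_basis_exists u_span.
have [Q QE] := choice (proj_adjoint pi_mem pi_sum sg_orth).
have dimE : (affdim (matroid_polytope u) + l)%N = N.
  (* The number of elements of block [j] in any basis is the trace of [Q j]. *)
  apply: (matroid_polytope_dim u_basis sg_surj (h := fun j => \tr (Q j))) => [B j bB|].
    by rewrite (basis_trace bB (QE j)).
  move=> c c_basis i k ik.
  apply: (indecomposable_block u_neq0 u_span pi_mem pi_sum sg_orth PL L_gt0 L_normal
    (PsP (sg k)) (Ps_compact _) (Ps_convex _) (Ps_indec _) u_basis c_basis) => //.
by apply/eqP; rewrite eq_sym subr_eq -PoszD dimE.
Qed.
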